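(* Consider the model $$\dot X_1=f(X_2)+dX_1,\qquad \dot X_2=X_1-g(X_2),$$ where $f:\mathbb{R}\to\mathbb{R}$ and $g:\mathbb{R}\to\mathbb{R}$ are unknown functions and $d\in\mathbb{R}$ is an unknown parameter. If only $X_2$ is observable, then the unknown functions $f$ and $g$ are both structurally non-identifiable. Specifically, given any admissible triplet $(f_1,g_1,d_1)$, any alternative choice of the form $$d_2\in\mathbb{R},\qquad g_2(X_2)=g_1(X_2)+(d_2-d_1)X_2,$$ $$f_2(X_2)=f_1(X_2)+d_1g_1(X_2)-d_2g_1(X_2)-d_2(d_2-d_1)X_2,$$ yields dynamics identical to $(f_1,g_1,d_1)$ with respect to $X_2$.
   Context: An ODE model has the form $\dot{\boldsymbol X}(t)=\boldsymbol F(\boldsymbol X;\boldsymbol f,\boldsymbol p)$, $\boldsymbol Y(t)=\boldsymbol H(\boldsymbol X(t))$, with state $\boldsymbol X\in\mathbb{R}^n$, observed output $\boldsymbol Y$ consisting of some or all of the state variables, known $\boldsymbol F,\boldsymbol H$, unknown scalar parameters $\boldsymbol p$, and unknown real-valued functions $\boldsymbol f$. Unknown functions are understood to be regular enough that solutions exist and the derivatives that occur make sense; a choice of unknowns is admissible if it is a possible choice of functions and parameters for the model. Two choices of the unknowns give the same observed outputs (yield identical dynamics with respect to the observed variable) if they produce the same output trajectory $\boldsymbol Y(t)$ for every initial condition consistent with prior knowledge of the initial conditions. Here the known initial conditions are $\boldsymbol Y(0)$; initial values of unobserved states are unknown and may differ between the two choices. Two choices are indistinguishable if they generate the same input-output equation,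 i.e. the same differential equation involving only the observed variable, its derivatives and the unknowns, obtained by eliminating the unobserved state. Fix a generic choice of the unknowns. An unknown function is globally structurally identifiable if every choice giving the same observed outputs as the fixed choice has the same function; locally structurally identifiable if there is $\varepsilon>0$ such that every choice giving the same observed outputs, and for which the function is within sup-distance $<\varepsilon$ of the fixed one, has the same function; structurally non-identifiable otherwise. *)

(* Defs.v *)
From HB Require Import structures.
From mathcomp Require Import all_boot all_order all_algebra.
From mathcomp Require Import all_classical all_reals all_analysis.

Set Implicit Arguments.
Unset Strict Implicit.
Unset Printing Implicit Defensive.

Import Order.TTheory GRing.Theory Num.Theory.
Import numFieldNormedType.Exports.

Local Open Scope classical_set_scope.
Local Open Scope ring_scope.

(* A choice (f, g, d) of the unknowns of the model
     X1' = f(X2) + d X1,   X2' = X1 - g(X2),   Y = X2.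
   [{uniform R -> R}] is [R -> R] with the topology of uniform convergence;
   the product topology only matters in [generically]. *)
Definition choice_of (R : realType) :=
  ({uniform R -> R} * {uniform R -> R} * R)%type.

Section Model.
Variable R : realType.

Definition unk_f (c : choice_of R) : R -> R := c.1.1.
Definition unk_g (c : choice_of R) : R -> R := c.1.2.
Definition unk_d (c : choice_of R) : R := c.2.

Definition C1 (h : R -> R) : Prop :=
  (forall x, derivable h x 1) /\ continuous (derive1 h).

(* C^1 regularity: initial value problems are well posed, and the derivative
   g' occurring in the input-output equation makes sense. *)
Definition admissible : set (choice_of R) :=
  [set c | C1 (unk_f c) /\ C1 (unk_g c)].

(* (X1, X2) solves the model on [0, T), where T may be +oo.  Asking for the
   equations on (0, T) together with continuity on [0, T) is the same as asking
   for them on [0, T) with a one-sided derivative at 0, as the right-hand sides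
   are continuous. Values of X1 and X2 outside [0, T) are irrelevant. *)
Definition solution (c : choice_of R) (T : \bar R) (X1 X2 : R -> R) : Prop :=
  [/\ {within [set t : R | 0 <= t /\ (t%:E < T)%E], continuous X1},
      {within [set t : R | 0 <= t /\ (t%:E < T)%E], continuous X2} &
      forall t : R, 0 < t -> (t%:E < T)%E ->
        is_derive t 1 X1 (unk_f c (X2 t) + unk_d c * X1 t) /\
        is_derive t 1 X2 (X1 t - unk_g c (X2 t))].

(* Y is an output on [0, T) with known initial value Y(0) = y0; the initial
   value X1(0) is unconstrained. *)
Definition output (c : choice_of R) (T : \bar R) (y0 : R) (Y : R -> R) : Prop :=
  Y 0 = y0 /\ exists X1 : R -> R, solution c T X1 Y.

(* X1(0) being unknown and free to differ between the two choices, the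
   trajectories generated from y0 are compared as sets, on every horizon. *)
Definition same_outputs (c c' : choice_of R) : Prop :=
  forall (y0 : R) (T : \bar R), (0 < T)%E ->
    forall Y : R -> R, output c T y0 Y <-> output c' T y0 Y.

Definition sup_dist (h k : R -> R) : \bar R :=
  ereal_sup (range (fun x : R => (`|h x - k x|)%:E)).

(* Below, [u] selects the unknown function under study
   ([unk_f] or [unk_g]), and [c] is the fixed choice. *)
Definition globally_identifiable (u : choice_of R -> R -> R)
    (c : choice_of R) : Prop :=
  forall c', admissible c' -> same_outputs c' c -> u c' = u c.

Definition locally_identifiable (u : choice_of R -> R -> R)
    (c : choice_of R) : Prop :=
  exists2 e : R, 0 < e &
    forall c', admissible c' -> same_outputs c' c ->
      (sup_dist (u c') (u c) < e%:E)%E -> u c' = u c.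

Definition non_identifiable (u : choice_of R -> R -> R)
    (c : choice_of R) : Prop :=
  ~ globally_identifiable u c /\ ~ locally_identifiable u c.

(* P holds on a relatively open dense set of admissible choices. *)
Definition generically (P : choice_of R -> Prop) : Prop :=
  exists U : set (choice_of R),
    [/\ open U, admissible `<=` closure (U `&` admissible) &
        forall c, U c -> admissible c -> P c].

Definition structurally_non_identifiable (u : choice_of R -> R -> R) : Prop :=
  generically (non_identifiable u).

End Model.

(* Main.v *)
(** The input-output equation
      X2'' = (f + d g)(X2) + (d - g'(X2)) X2'
    depends on (f, g, d) only through f + d g and d - g'. It is therefore
    preserved when g(x) is replaced by g(x) + (d2 - d1) x + k and f is adjusted
    so as to keep f + d g, the change of unobserved state being
    X1 |-> X1 + (d2 - d1) X2 + k. The slope d2 - d1 gives the family of the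
    statement, which is at infinite sup-distance from the original choice;
    local non-identifiability comes from the constant k, which shifts g by k
    and f by - d k. Hence f is handled on the open dense set d <> 0 only. *)
Require Import Defs.
From mathcomp Require Import all_boot all_order all_algebra.
From mathcomp Require Import all_classical all_reals all_analysis.
From mathcomp Require Import ring.
Import Order.TTheory GRing.Theory Num.Theory.
Import numFieldNormedType.Exports.
Local Open Scope classical_set_scope.
Local Open Scope ring_scope.

(** The first clause is the equality of the two functions [d - g'] in integrated form, with [k] as
    the constant of integration; no derivative has to be mentioned. *)
Definition same_io_equation {R : realType} (k : R) (c c' : choice_of R) : Prop :=
  (forall x, unk_g c' x = unk_g c x + (unk_d c' - unk_d c) * x + k) /\
  (forall x, unk_f c' x + unk_d c' * unk_g c' x
             = unk_f c x + unk_d c * unk_g c x).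

Lemma same_io_equation_sym {R : realType} {k : R} {c c' : choice_of R} :
  same_io_equation k c c' -> same_io_equation (- k) c' c.
Proof. by move=> [hg hf]; split=> x; [rewrite hg; ring | rewrite hf]. Qed.

(** Both transformed unknowns have this shape once the relations between the two choices are solved
    for them, so admissibility carries over. *)
Lemma C1_lincomb {R : realType} (u v : R -> R) (a b k : R) :
  C1 u -> C1 v -> C1 (fun x => u x + a * v x + b * x + k).
Proof.
move=> [du cu] [dv cv].
have D (x : R) : is_derive x (1 : R) (fun y => u y + a * v y + b * y + k)
    (derive1 u x + a * derive1 v x + b).
  have hu : is_derive x 1 u (derive1 u x).
    by rewrite derive1E; apply: DeriveDef.
  have hv : is_derive x 1 v (derive1 v x).
    by rewrite derive1E; apply: DeriveDef.
  have := is_deriveD (is_deriveD (is_deriveD hu (is_deriveZ a hv))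
    (is_deriveZ b (is_derive_id x 1))) (is_derive_cst k x 1).
  by move/is_derive_eq; apply; rewrite addr0 /GRing.scale /= mulr1.
split=> [x|]; first exact: ex_derive.
rewrite (_ : derive1 _ = fun x => derive1 u x + a * derive1 v x + b).
  move=> x; apply: cvgD; last exact: cvg_cst.
  by apply: cvgD; [exact: cu | apply: cvgM; [exact: cvg_cst | exact: cv]].
by apply/funext => x; rewrite derive1E derive_val.
Qed.

Lemma same_io_equation_admissible {R : realType} {k : R} {c c' : choice_of R} :
  same_io_equation k c c' -> admissible c -> admissible c'.
Proof.
move=> [hg hf] [Cf Cg]; split; last first.
  rewrite (_ : unk_g c' =
    fun x => unk_g c x + 0 * unk_g c x + (unk_d c' - unk_d c) * x + k).
    exact: C1_lincomb.
  by apply/funext => x; rewrite hg mul0r addr0.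
rewrite (_ : unk_f c' =
  fun x => unk_f c x + (unk_d c - unk_d c') * unk_g c x
    + (- unk_d c' * (unk_d c' - unk_d c)) * x + (- unk_d c' * k)).
  exact: C1_lincomb.
apply/funext => x; apply: (addIr (unk_d c' * unk_g c' x)).
by rewrite hf hg; ring.
Qed.

Lemma same_io_equation_output {R : realType} {k : R} {c c' : choice_of R}
    {T : \bar R} {y0 : R} {Y : R -> R} :
  same_io_equation k c c' -> output c T y0 Y -> output c' T y0 Y.
Proof.
move=> [hg hf] [Y0 [X1 [cX cY dXY]]]; split=> //.
(* [X1] is raised by exactly the increment of [g] along [Y], so [X1 - g(Y)], hence the equation for
   [Y], is unchanged. *)
exists (fun t => X1 t + (unk_d c' - unk_d c) * Y t + k); split=> //.
  move=> t; apply: cvgD; last exact: cvg_cst.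
  by apply: cvgD; [exact: cX | apply: cvgM; [exact: cvg_cst | exact: cY]].
move=> t t0 tT; have [dX dY] := dXY t t0 tT; split.
  have := is_deriveD (is_deriveD dX (is_deriveZ (unk_d c' - unk_d c) dY))
    (is_derive_cst k t 1).
  move/is_derive_eq; apply; rewrite addr0 /GRing.scale /=.
  (* The new [f] is known only through [f + d g]; adding the missing term to both sides makes that
     sum appear. *)
  apply: (addIr (unk_d c' * unk_g c' (Y t))).
  by rewrite [RHS]addrAC hf hg; ring.
by move: dY => /is_derive_eq; apply; rewrite hg; ring.
Qed.

Lemma same_io_equation_same_outputs {R : realType} {k : R}
    {c c' : choice_of R} :
  same_io_equation k c c' -> same_outputs c' c.
Proof.
move=> h y0 T _ Y; split; apply: same_io_equation_output; last exact: h.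
exact: same_io_equation_sym h.
Qed.

Definition shift_choice {R : realType} (k : R) (c : choice_of R) : choice_of R :=
  (fun x => unk_f c x - unk_d c * k, fun x => unk_g c x + k, unk_d c).

Lemma shift_choice_same_io_equation {R : realType} (k : R) (c : choice_of R) :
  same_io_equation k c (shift_choice k c).
Proof.
split=> x; first by rewrite subrr mul0r addr0.
rewrite -[LHS]/(unk_f c x - unk_d c * k + unk_d c * (unk_g c x + k)).
by ring.
Qed.

Lemma sup_dist_cst {R : realType} {h h' : R -> R} {a : R} :
  (forall x, h' x = h x + a) -> sup_dist h' h = `|a|%:E.
Proof.
move=> hh; rewrite /sup_dist.
have -> : range (fun x => `|h' x - h x|%:E) = [set `|a|%:E].
  apply/seteqP; split=> [_ [x _ <-]|_ ->] /=; first by rewrite hh addrC addKr.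
  by exists 0 => //; rewrite hh addrC addKr.
exact: ereal_sup1.
Qed.

(** Here [b] is the rate at which the studied unknown moves with [k]: any nonzero rate yields
    output-equivalent choices arbitrarily close in sup-distance. *)
Lemma non_identifiable_shift {R : realType} (u : choice_of R -> R -> R)
    (c : choice_of R) (b : R) : b != 0 -> admissible c ->
  (forall k x, u (shift_choice k c) x = u c x + b * k) ->
  non_identifiable u c.
Proof.
move=> b0 adm hu.
have loc : ~ locally_identifiable u c.
  (* This [k] displaces [u] by the constant [e / 2], which is nonzero yet below the radius [e]. *)
  move=> [e e0 /(_ (shift_choice (e / 2 / b) c))].
  have hs := shift_choice_same_io_equation (e / 2 / b) c.
  move=> /(_ (same_io_equation_admissible hs adm)).
  move=> /(_ (same_io_equation_same_outputs hs)).
  rewrite (sup_dist_cst (hu _)) mulrC divfK// lte_fin.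
  rewrite gtr0_norm ?divr_gt0// gtr_pMr// invf_lt1// ltr1n.
  move=> /(_ isT) /(congr1 (@^~ 0)); rewrite hu mulrC divfK//.
  by move=> /eqP; rewrite -subr_eq0 addrC addKr gt_eqF// divr_gt0.
split=> // glob; apply: loc; exists 1 => // c' adm' same _; exact: glob.
Qed.

Lemma open_unk_d_neq0 {R : realType} : open [set c : choice_of R | unk_d c != 0].
Proof.
apply: (@open_comp (choice_of R) R snd [set x : R | x != 0]);
  last exact: open_neq.
by move=> c _; exact: cvg_snd.
Qed.

(** Perturbing [d] alone suffices, since admissibility constrains only [f] and [g]. *)
Lemma unk_d_neq0_dense {R : realType} :
  @admissible R `<=` closure ([set c | unk_d c != 0] `&` @admissible R).
Proof.
move=> [fg d] adm B nB.
have cvgd : (fun t : R => (fg, t)) @ d --> (fg, d).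
  exact: (@cvg_pair _ _ _ _ (nbhs fg) (nbhs d) _ _ _ _ _ (cvg_cst fg) cvg_id).
(* The punctured filter covers the case [d = 0], where the point itself must be avoided. *)
have nz : \forall t \near d^', t != 0.
  have [->|d0] := eqVneq d 0; first exact: nbhs_dnbhs_neq.
  by apply: nbhs_dnbhs; apply: open_nbhs_nbhs; split=> //; exact: open_neq.
have nB' : \forall t \near d^', B (fg, t).
  by apply: nbhs_dnbhs; exact: (cvgd B nB).
have [t [t0 Bt]] := filter_ex (filterI nz nB').
by exists (fg, t).
Qed.

Theorem proposition5p1 (R : realType) :
  [/\ structurally_non_identifiable (@unk_f R),
      structurally_non_identifiable (@unk_g R) &
      forall (f1 g1 : R -> R) (d1 : R), admissible (f1, g1, d1) ->
      forall (f2 g2 : R -> R) (d2 : R),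
        (forall x, g2 x = g1 x + (d2 - d1) * x) ->
        (forall x, f2 x = f1 x + d1 * g1 x - d2 * g1 x
                          - d2 * (d2 - d1) * x) ->
        admissible (f2, g2, d2) /\
        same_outputs (f2, g2, d2) (f1, g1, d1)].
Proof.
split.
- exists [set c | unk_d c != 0]; split; first exact: open_unk_d_neq0.
    exact: unk_d_neq0_dense.
  move=> c d0 adm; apply: (@non_identifiable_shift _ _ _ (- unk_d c)) => //.
    by rewrite oppr_eq0.
  by move=> k x; rewrite mulNr.
- exists setT; split; first exact: openT.
    by rewrite setTI; exact: subset_closure.
  move=> c _ adm; apply: (@non_identifiable_shift _ _ _ 1) => //.
  by move=> k x; rewrite mul1r.
- move=> f1 g1 d1 adm f2 g2 d2 hg hf.
  (* The family of the statement is the case of zero integration constant. *)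
  have h : same_io_equation 0 (f1, g1, d1) (f2, g2, d2).
    by split=> x; rewrite /unk_f /unk_g /unk_d /= ?hf !hg; ring.
  split; first exact: same_io_equation_admissible h adm.
  exact: same_io_equation_same_outputs h.
Qed.
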